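(* Let $H = (H,\mu_H,\Delta_H,\alpha_H)$ be a Hom-bialgebra, $A = (A,\mu_A,\alpha_A)$ be a Hom-associative algebra, and $\rho \colon H \otimes A \to A$, written $\rho(x,a)=xa$, be an $H$-module structure on $(A,\alpha_A)$ (all over $\mathbf{k}$). Then the module Hom-algebra axiom \[ \alpha_H^2(x)(ab) = \sum_{(x)} (x_1a)(x_2b) \quad\text{for all } x \in H,\ a,b \in A \] is satisfied if and only if $\mu_A \colon A^{\otimes 2} \to A$ is a morphism of $H$-modules, in which $A^{\otimes 2}$ and $A$ are given the $H$-module structure maps \[ \rho_{AA} = (\rho \otimes \rho) \circ (Id_H \otimes \tau_{H,A} \otimes Id_A) \circ (\Delta_H \otimes Id_A \otimes Id_A) \colon H \otimes A \otimes A \to A \otimes A \] and \[ \rho^{2,0} = \rho \circ (\alpha_H^2 \otimes Id_A) \colon H \otimes A \to A, \] respectively.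
   Context: $\mathbf{k}$ is a fixed associative and commutative ring of characteristic $0$; modules, tensor products and linear maps are over $\mathbf{k}$. $\alpha_H^2=\alpha_H\circ\alpha_H$. $\tau_{V,W}\colon V\otimes W\to W\otimes V$, $v\otimes w\mapsto w\otimes v$, is the twist isomorphism. $\mu_A(a,b)$ is written $ab$; $\Delta_H(x)=\sum_{(x)} x_1\otimes x_2$ is Sweedler's notation. A Hom-associative algebra $(A,\mu,\alpha)$ is a $\mathbf{k}$-module $A$ with linear maps $\mu\colon A^{\otimes 2}\to A$, $\alpha\colon A\to A$ such that $\alpha\circ\mu=\mu\circ\alpha^{\otimes 2}$ and $\mu\circ(\alpha\otimes\mu)=\mu\circ(\mu\otimes\alpha)$. A Hom-coassociative coalgebra $(C,\Delta,\alpha)$ is a $\mathbf{k}$-module $C$ with linear maps $\Delta\colon C\to C^{\otimes 2}$, $\alpha\colon C\to C$ such that $\alpha^{\otimes 2}\circ\Delta=\Delta\circ\alpha$ and $(\alpha\otimes\Delta)\circ\Delta=(\Delta\otimes\alpha)\circ\Delta$. A Hom-bialgebra $(H,\mu,\Delta,\alpha)$ is such that $(H,\mu,\alpha)$ is a Hom-associative algebra, $(H,\Delta,\alpha)$ is a Hom-coassociative coalgebra, and $\Delta\circ\mu=\mu^{\otimes 2}\circ(Id\otimes\tau\otimes Id)\circ\Delta^{\otimes 2}$. A Hom-module is a pair $(M,\alpha_M)$ of a $\mathbf{k}$-module $M$ and a linear self-map $\alpha_M$; a morphism of Hom-modules $f\colon (M,\alpha_M)\to(N,\alpha_N)$ is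 a linear map with $\alpha_N\circ f=f\circ\alpha_M$; the tensor product of $(M,\alpha_M)$ and $(N,\alpha_N)$ is $(M\otimes N,\alpha_M\otimes\alpha_N)$. An $H$-module (for the Hom-associative algebra $(H,\mu_H,\alpha_H)$) is a Hom-module $(M,\alpha_M)$ with a linear structure map $\rho\colon H\otimes M\to M$ such that $\alpha_M\circ\rho=\rho\circ(\alpha_H\otimes\alpha_M)$ and $\rho\circ(\alpha_H\otimes\rho)=\rho\circ(\mu_H\otimes\alpha_M)$. A morphism $f\colon M\to N$ of $H$-modules is a morphism of Hom-modules with $f\circ\rho_M=\rho_N\circ(Id_H\otimes f)$. Here $A^{\otimes 2}$ has twisting map $\alpha_A\otimes\alpha_A$ and $A$ has twisting map $\alpha_A$. *)

(* Defs.v *)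
From HB Require Import structures.
From mathcomp Require Import all_boot all_order all_algebra.
From mathcomp Require Import boolp.

Set Implicit Arguments.
Unset Strict Implicit.
Unset Printing Implicit Defensive.

Import GRing.Theory.
Local Open Scope ring_scope.
Local Open Scope quotient_scope.

Reserved Notation "U ⊗ V" (at level 40, left associativity).
Reserved Notation "u ⊗ₜ v" (at level 40, left associativity).

(* MathComp has no tensor product of arbitrary modules.  It is built here as
   the set of formal finite sums of pure tensors (sequences of pairs, added by
   concatenation) modulo the congruence generated by the usual relations. *)
Section TensorDef.
Variables (k : comNzRingType) (U V : lmodType k).

(* Formal sums only form a monoid, hence the explicit relation u ⊗ 0 = 0. *)
Inductive tens_rel : seq (U * V) -> seq (U * V) -> Prop :=
| TensRefl s : tens_rel s s
| TensSym s t : tens_rel s t -> tens_rel t s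
| TensTrans s t r : tens_rel s t -> tens_rel t r -> tens_rel s r
| TensCat s s' t t' :
    tens_rel s s' -> tens_rel t t' -> tens_rel (s ++ t) (s' ++ t')
| TensCatC s t : tens_rel (s ++ t) (t ++ s)
| TensDl u u' v : tens_rel [:: (u + u', v)] [:: (u, v); (u', v)]
| TensDr u v v' : tens_rel [:: (u, v + v')] [:: (u, v); (u, v')]
| TensZ (a : k) u v : tens_rel [:: (a *: u, v)] [:: (u, a *: v)]
| Tens0 u : tens_rel [:: (u, 0)] [::].

Definition tens_relb (s t : seq (U * V)) : bool := `[< tens_rel s t >].

Lemma tens_relb_refl : reflexive tens_relb.
Proof. by move=> s; apply/asboolP; exact: TensRefl. Qed.

Lemma tens_relb_sym : symmetric tens_relb.
Proof. by move=> s t; apply/asboolP/asboolP; exact: TensSym. Qed.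

Lemma tens_relb_trans : transitive tens_relb.
Proof.
move=> t s r /asboolP st /asboolP tr.
by apply/asboolP; exact: TensTrans st tr.
Qed.

Canonical tens_equiv :=
  EquivRel tens_relb tens_relb_refl tens_relb_sym tens_relb_trans.

Definition tensor := {eq_quot tens_equiv}.

HB.instance Definition _ := Choice.copy tensor {eq_quot tens_equiv}.

Definition tcls (s : seq (U * V)) : tensor := \pi_({eq_quot tens_equiv}) s.
Definition trep (t : tensor) : seq (U * V) := repr (t : {eq_quot tens_equiv}).

Lemma trepK t : tcls (trep t) = t.
Proof. by rewrite /tcls /trep reprK. Qed.

Lemma tcls_eq s t : tens_rel s t <-> tcls s = tcls t.
Proof.
split=> [st|]; first by apply/eqmodP/asboolP.
by move/eqmodP => /asboolP.
Qed.

Lemma trep_cls s : tens_rel (trep (tcls s)) s.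
Proof. by apply/tcls_eq; rewrite trepK. Qed.

Definition tadd (t1 t2 : tensor) : tensor := tcls (trep t1 ++ trep t2).
Definition tscale (a : k) (t : tensor) : tensor :=
  tcls [seq (a *: p.1, p.2) | p <- trep t].
Definition topp (t : tensor) : tensor := tscale (-1) t.
Definition tzero : tensor := tcls [::].

Lemma tadd_cls s1 s2 : tadd (tcls s1) (tcls s2) = tcls (s1 ++ s2).
Proof. by apply/tcls_eq/TensCat; exact: trep_cls. Qed.

Lemma tens_rel0l v : tens_rel [:: (0, v)] [::].
Proof.
have := TensZ 0 0 v; rewrite !scale0r => h.
exact: (TensTrans h (Tens0 0)).
Qed.

Lemma tens_rel_map a s t : tens_rel s t ->
  tens_rel [seq (a *: p.1, p.2) | p <- s] [seq (a *: p.1, p.2) | p <- t].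
Proof.
elim=> {s t}.
- by move=> s; exact: TensRefl.
- by move=> s t _ h; exact: TensSym.
- by move=> s t r _ h _ h'; exact: (TensTrans h h').
- by move=> s s' t t' _ h _ h'; rewrite !map_cat; exact: TensCat.
- by move=> s t; rewrite !map_cat; exact: TensCatC.
- by move=> u u' v /=; rewrite scalerDr; exact: TensDl.
- by move=> u v v' /=; exact: TensDr.
- by move=> b u v /=; rewrite scalerA mulrC -scalerA; exact: TensZ.
- by move=> u /=; exact: Tens0.
Qed.

Lemma tscale_cls a s : tscale a (tcls s) = tcls [seq (a *: p.1, p.2) | p <- s].
Proof. by apply/tcls_eq/tens_rel_map; exact: trep_cls. Qed.

Lemma taddA : associative tadd.
Proof.
move=> x y z; rewrite -(trepK x) -(trepK y) -(trepK z).
by rewrite !tadd_cls catA.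
Qed.

Lemma taddC : commutative tadd.
Proof. by move=> x y; apply/tcls_eq; exact: TensCatC. Qed.

Lemma tadd0 : left_id tzero tadd.
Proof. by move=> x; rewrite -(trepK x) tadd_cls. Qed.

Lemma tcls_cons p s : tcls (p :: s) = tadd (tcls [:: p]) (tcls s).
Proof. by rewrite tadd_cls. Qed.

Lemma tscale_cls1 a u v : tscale a (tcls [:: (u, v)]) = tcls [:: (a *: u, v)].
Proof. by rewrite tscale_cls. Qed.

Lemma taddDl a b t : tscale (a + b) t = tadd (tscale a t) (tscale b t).
Proof.
rewrite -(trepK t) !tscale_cls; elim: (trep t) => [|p s IHs] /=.
  by rewrite tadd_cls.
have := TensDl (a *: p.1) (b *: p.1) p.2; rewrite -scalerDl => /tcls_eq h.
rewrite tcls_cons h IHs [in LHS]tcls_cons.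
rewrite [tcls ((a *: _, _) :: map _ _)]tcls_cons.
rewrite [tcls ((b *: _, _) :: map _ _)]tcls_cons.
rewrite -!taddA; congr (tadd _ _); rewrite !taddA; congr (tadd _ _).
exact: taddC.
Qed.

Lemma tscale0 t : tscale 0 t = tzero.
Proof.
rewrite -(trepK t) tscale_cls; elim: (trep t) => [//|p s IHs] /=.
rewrite -cat1s -tadd_cls IHs taddC tadd0 scale0r.
by apply/tcls_eq; exact: tens_rel0l.
Qed.

Lemma tscale1 : left_id 1 tscale.
Proof.
move=> t; rewrite -{2}(trepK t) -[X in tscale _ X]trepK tscale_cls; congr tcls.
by rewrite -[RHS]map_id; apply: eq_map => -[u v] /=; rewrite scale1r.
Qed.

Lemma tscaleA a b t : tscale a (tscale b t) = tscale (a * b) t.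
Proof.
rewrite -(trepK t) !tscale_cls -map_comp; congr tcls.
by apply: eq_map => -[u v] /=; rewrite scalerA.
Qed.

Lemma tscaleDr : right_distributive tscale tadd.
Proof.
move=> a x y; rewrite -(trepK x) -(trepK y).
by rewrite !(tadd_cls, tscale_cls) map_cat.
Qed.

Lemma taddN : left_inverse tzero topp tadd.
Proof.
by move=> t; rewrite /topp -{2}(tscale1 t) -taddDl addNr tscale0.
Qed.

HB.instance Definition _ := GRing.isZmodule.Build tensor taddA taddC tadd0 taddN.

HB.instance Definition _ := GRing.Zmodule_isLmodule.Build k tensor
  tscaleA tscale1 tscaleDr (fun t a b => taddDl a b t).

Definition tens (u : U) (v : V) : tensor := tcls [:: (u, v)].

End TensorDef.

Notation "U ⊗ V" := (tensor U V) : type_scope.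
Notation "u ⊗ₜ v" := (tens u v) : ring_scope.

Section TensorTheory.
Variables (k : comNzRingType) (U V : lmodType k).

Lemma tens_is_bilinear : bilinear_for *:%R *:%R (@tens k U V).
Proof.
split=> [v a u u'|u a v v'].
  have /tcls_eq h := TensDl (a *: u) u' v.
  by rewrite /applyr /tens h [in LHS]tcls_cons -tscale_cls1.
have /tcls_eq h := TensDr u (a *: v) v'.
have /tcls_eq h' := TensZ a u v.
by rewrite /tens h [in LHS]tcls_cons -h' -tscale_cls1.
Qed.

HB.instance Definition _ :=
  bilinear_isBilinear.Build k U V (tensor U V) *:%R *:%R (@tens k U V)
    tens_is_bilinear.

Lemma tclsE (s : seq (U * V)) : tcls s = \sum_(p <- s) p.1 ⊗ₜ p.2.
Proof.
elim: s => [|[u v] s IHs]; first by rewrite big_nil.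
by rewrite big_cons -IHs [in LHS]tcls_cons.
Qed.

Lemma tensor_decomp (t : U ⊗ V) :
  exists s : seq (U * V), t = \sum_(p <- s) p.1 ⊗ₜ p.2.
Proof. by exists (trep t); rewrite -tclsE trepK. Qed.

Lemma tensor_ext (W : lmodType k) (f g : {linear U ⊗ V -> W}) :
  (forall u v, f (u ⊗ₜ v) = g (u ⊗ₜ v)) -> f =1 g.
Proof.
move=> fg t; have [s ->] := tensor_decomp t; rewrite !linear_sum.
by apply: eq_bigr => p _.
Qed.

Lemma tensor_ind (P : U ⊗ V -> Prop) :
  (forall u v, P (u ⊗ₜ v)) -> (forall t t', P t -> P t' -> P (t + t')) ->
  forall t, P t.
Proof.
move=> Ptens PD t; have [s ->] := tensor_decomp t.
elim: s => [|p s IHs]; last by rewrite big_cons; exact: PD.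
rewrite big_nil; have <- : (0 : U) ⊗ₜ (0 : V) = 0; last exact: Ptens.
by apply/tcls_eq; exact: Tens0.
Qed.

Section Lift.
Variables (W : lmodType k) (f : {bilinear U -> V -> W}).

Definition tlift (t : U ⊗ V) : W := \sum_(p <- trep t) f p.1 p.2.

Lemma tlift_rel s t : tens_rel s t ->
  \sum_(p <- s) f p.1 p.2 = \sum_(p <- t) f p.1 p.2.
Proof.
elim=> {s t}.
- by [].
- by move=> s t _ ->.
- by move=> s t r _ -> _ ->.
- by move=> s s' t t' _ h _ h'; rewrite !big_cat /= h h'.
- by move=> s t; rewrite !big_cat /= addrC.
- by move=> u u' v; rewrite !big_cons !big_nil /= !addr0 linearDl.
- by move=> u v v'; rewrite !big_cons !big_nil /= !addr0 linearD.
- by move=> a u v; rewrite !big_cons !big_nil /= !addr0 linearZl_LR linearZ.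
- by move=> u; rewrite big_cons !big_nil /= linear0 addr0.
Qed.

Lemma tlift_cls s : tlift (tcls s) = \sum_(p <- s) f p.1 p.2.
Proof. exact/tlift_rel/trep_cls. Qed.

Lemma tlift_is_linear : linear tlift.
Proof.
move=> a x y.
have -> : a *: x + y = tcls ([seq (a *: p.1, p.2) | p <- trep x] ++ trep y).
  by rewrite -tadd_cls -tscale_cls !trepK.
rewrite tlift_cls big_cat big_map /=; congr (_ + _); rewrite /tlift scaler_sumr.
by apply: eq_bigr => p _; rewrite linearZl_LR.
Qed.

HB.instance Definition _ :=
  GRing.isLinear.Build k (tensor U V) W *:%R tlift tlift_is_linear.

Lemma tliftE u v : tlift (u ⊗ₜ v) = f u v.
Proof. by rewrite tlift_cls big_seq1. Qed.

End Lift.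
End TensorTheory.

Section TensorMaps.
Variable k : comNzRingType.

Section Map.
Variables (U V U' V' : lmodType k).
Variables (f : {linear U -> U'}) (g : {linear V -> V'}).

Definition tmap_fun (u : U) (v : V) : U' ⊗ V' := f u ⊗ₜ g v.

Lemma tmap_fun_bilinear : bilinear_for *:%R *:%R tmap_fun.
Proof.
split=> [v a u u'|u a v v']; rewrite /tmap_fun ?/applyr.
  by rewrite linearP linearPl.
by rewrite linearP linearPr.
Qed.

HB.instance Definition _ :=
  bilinear_isBilinear.Build k U V (tensor U' V') *:%R *:%R tmap_fun
    tmap_fun_bilinear.

Definition tmap : U ⊗ V -> U' ⊗ V' := tlift tmap_fun.

HB.instance Definition _ := GRing.Linear.on tmap.

Lemma tmapE u v : tmap (u ⊗ₜ v) = f u ⊗ₜ g v.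
Proof. exact: tliftE. Qed.

End Map.

Section Twist.
Variables U V : lmodType k.

Definition ttwist_fun (u : U) (v : V) : V ⊗ U := v ⊗ₜ u.

Lemma ttwist_fun_bilinear : bilinear_for *:%R *:%R ttwist_fun.
Proof.
split=> [v a u u'|u a v v']; rewrite /ttwist_fun ?/applyr.
  by rewrite linearPr.
by rewrite linearPl.
Qed.

HB.instance Definition _ :=
  bilinear_isBilinear.Build k U V (tensor V U) *:%R *:%R ttwist_fun
    ttwist_fun_bilinear.

Definition ttwist : U ⊗ V -> V ⊗ U := tlift ttwist_fun.

HB.instance Definition _ := GRing.Linear.on ttwist.

Lemma ttwistE u v : ttwist (u ⊗ₜ v) = v ⊗ₜ u.
Proof. exact: tliftE. Qed.

End Twist.

Section Assoc.
Variables U V W : lmodType k.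

Definition tassoc_fun1 (w : W) (u : U) (v : V) : U ⊗ (V ⊗ W) := u ⊗ₜ (v ⊗ₜ w).

Lemma tassoc_fun1_bilinear w : bilinear_for *:%R *:%R (tassoc_fun1 w).
Proof.
split=> [v a u u'|u a v v']; rewrite /tassoc_fun1 ?/applyr.
  by rewrite linearPl.
by rewrite linearPl linearPr.
Qed.

HB.instance Definition _ w :=
  bilinear_isBilinear.Build k U V (tensor U (tensor V W)) *:%R *:%R
    (tassoc_fun1 w) (tassoc_fun1_bilinear w).

Definition tassoc_fun (t : U ⊗ V) (w : W) : U ⊗ (V ⊗ W) :=
  tlift (tassoc_fun1 w) t.

Lemma tassoc_fun_bilinear : bilinear_for *:%R *:%R tassoc_fun.
Proof.
split=> [w a t t'|t a w w']; rewrite /tassoc_fun ?/applyr.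
  by rewrite linearP.
rewrite /tlift [RHS]/= scaler_sumr -big_split; apply: eq_bigr => p _ /=.
by rewrite /tassoc_fun1 !linearPr.
Qed.

HB.instance Definition _ :=
  bilinear_isBilinear.Build k (tensor U V) W (tensor U (tensor V W))
    *:%R *:%R tassoc_fun tassoc_fun_bilinear.

Definition tassoc : (U ⊗ V) ⊗ W -> U ⊗ (V ⊗ W) := tlift tassoc_fun.

HB.instance Definition _ := GRing.Linear.on tassoc.

Lemma tassocE u v w : tassoc ((u ⊗ₜ v) ⊗ₜ w) = u ⊗ₜ (v ⊗ₜ w).
Proof. by rewrite /tassoc tliftE /= /tassoc_fun tliftE. Qed.

Definition tassocV_fun1 (u : U) (v : V) (w : W) : (U ⊗ V) ⊗ W :=
  (u ⊗ₜ v) ⊗ₜ w.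

Lemma tassocV_fun1_bilinear u : bilinear_for *:%R *:%R (tassocV_fun1 u).
Proof.
split=> [w a v v'|v a w w']; rewrite /tassocV_fun1 ?/applyr.
  by rewrite linearPr linearPl.
by rewrite linearPr.
Qed.

HB.instance Definition _ u :=
  bilinear_isBilinear.Build k V W (tensor (tensor U V) W) *:%R *:%R
    (tassocV_fun1 u) (tassocV_fun1_bilinear u).

Definition tassocV_fun (u : U) (t : V ⊗ W) : (U ⊗ V) ⊗ W :=
  tlift (tassocV_fun1 u) t.

Lemma tassocV_fun_bilinear : bilinear_for *:%R *:%R tassocV_fun.
Proof.
split=> [t a u u'|u a t t']; rewrite /tassocV_fun ?/applyr; last first.
  by rewrite linearP.
rewrite /tlift [RHS]/= scaler_sumr -big_split; apply: eq_bigr => p _ /=.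
by rewrite /tassocV_fun1 !linearPl.
Qed.

HB.instance Definition _ :=
  bilinear_isBilinear.Build k U (tensor V W) (tensor (tensor U V) W)
    *:%R *:%R tassocV_fun tassocV_fun_bilinear.

Definition tassocV : U ⊗ (V ⊗ W) -> (U ⊗ V) ⊗ W := tlift tassocV_fun.

HB.instance Definition _ := GRing.Linear.on tassocV.

Lemma tassocVE u v w : tassocV (u ⊗ₜ (v ⊗ₜ w)) = (u ⊗ₜ v) ⊗ₜ w.
Proof. by rewrite /tassocV tliftE /= /tassocV_fun tliftE. Qed.

End Assoc.

(* [Id ⊗ τ ⊗ Id], conjugated by the associativity isomorphisms. *)
Section Mid.
Variables U V W X : lmodType k.

Definition tmid : (U ⊗ V) ⊗ (W ⊗ X) -> (U ⊗ W) ⊗ (V ⊗ X) :=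
  @tassocV U W (V ⊗ X)
  \o tmap idfun (@tassoc W V X \o tmap (@ttwist V W) idfun \o @tassocV V W X)
  \o @tassoc U V (W ⊗ X).

HB.instance Definition _ := GRing.Linear.on tmid.

Lemma tmidE u v w x :
  tmid ((u ⊗ₜ v) ⊗ₜ (w ⊗ₜ x)) = (u ⊗ₜ w) ⊗ₜ (v ⊗ₜ x).
Proof.
by rewrite /tmid /= tassocE tmapE /= tassocVE tmapE /= ttwistE tassocE tassocVE.
Qed.

End Mid.
End TensorMaps.

Section HomStructures.
Variable k : comNzRingType.

Record hom_module := HomModule {
  hm_sort :> lmodType k;
  hm_twist : {linear hm_sort -> hm_sort}
}.

Definition hom_module_morphism (M N : hom_module) (f : M -> N) : Prop :=
  hm_twist N \o f =1 f \o hm_twist M.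

Definition tensor_hom_module (M N : hom_module) : hom_module :=
  @HomModule (M ⊗ N) (tmap (hm_twist M) (hm_twist N)).

(* [@tassoc _ U V W] identifies (U ⊗ V) ⊗ W with U ⊗ (V ⊗ W). *)
Definition hom_associative (A : hom_module) (mu : {linear A ⊗ A -> A}) : Prop :=
  let alpha := hm_twist A in
  alpha \o mu =1 mu \o tmap alpha alpha /\
  mu \o tmap alpha mu \o @tassoc _ A A A =1 mu \o tmap mu alpha.

Definition hom_coassociative (C : hom_module)
    (Delta : {linear C -> C ⊗ C}) : Prop :=
  let alpha := hm_twist C in
  tmap alpha alpha \o Delta =1 Delta \o alpha /\
  tmap alpha Delta \o Delta
    =1 @tassoc _ C C C \o tmap Delta alpha \o Delta.

Record hom_alg := HomAlg {
  ha_module :> hom_module;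
  ha_mul : {linear ha_module ⊗ ha_module -> ha_module};
  ha_algP : hom_associative ha_mul
}.

Record hom_bialg := HomBialg {
  hb_alg :> hom_alg;
  hb_comul : {linear hb_alg -> hb_alg ⊗ hb_alg};
  hb_coalgP : hom_coassociative hb_comul;
  hb_comulM :
    hb_comul \o ha_mul hb_alg
    =1 tmap (ha_mul hb_alg) (ha_mul hb_alg)
         \o @tmid _ hb_alg hb_alg hb_alg hb_alg \o tmap hb_comul hb_comul
}.

Record hmodule (H : hom_alg) (M : hom_module) := HModule {
  hmod_act :> {linear H ⊗ M -> M};
  hmod_twist :
    hm_twist M \o hmod_act =1 hmod_act \o tmap (hm_twist H) (hm_twist M);
  hmod_actA :
    hmod_act \o tmap (hm_twist H) hmod_act \o @tassoc _ H H M
    =1 hmod_act \o tmap (ha_mul H) (hm_twist M)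
}.

Definition hmodule_morphism (H : hom_alg) (M N : hom_module)
    (rhoM : hmodule H M) (rhoN : hmodule H N) (f : {linear M -> N}) : Prop :=
  hom_module_morphism f /\ f \o rhoM =1 rhoN \o tmap idfun f.

Section TensorHModule.
Variables (H : hom_bialg) (M N : hom_module).
Variables (rhoM : hmodule H M) (rhoN : hmodule H N).

Definition tensor_act : H ⊗ (M ⊗ N) -> M ⊗ N :=
  tmap rhoM rhoN \o @tmid _ H H M N \o tmap (hb_comul H) idfun.

HB.instance Definition _ := GRing.Linear.on tensor_act.

Let K (p : H ⊗ H) (t : M ⊗ N) : M ⊗ N := tmap rhoM rhoN (tmid (p ⊗ₜ t)).

Let KE x y m n : K (x ⊗ₜ y) (m ⊗ₜ n) = rhoM (x ⊗ₜ m) ⊗ₜ rhoN (y ⊗ₜ n).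
Proof. by rewrite /K tmidE tmapE. Qed.

Let KDl p p' t : K (p + p') t = K p t + K p' t.
Proof. by rewrite /K linearDl !linearD. Qed.

Let KDr p t t' : K p (t + t') = K p t + K p t'.
Proof. by rewrite /K linearDr !linearD. Qed.

Let tensor_actE x t : tensor_act (x ⊗ₜ t) = K (hb_comul H x) t.
Proof. by rewrite /tensor_act /= tmapE. Qed.

Let K_twist p t :
  tmap (hm_twist M) (hm_twist N) (K p t)
  = K (tmap (hm_twist H) (hm_twist H) p) (tmap (hm_twist M) (hm_twist N) t).
Proof.
elim/tensor_ind: p => [x y|p p' IH IH']; last first.
  by rewrite KDl !linearD /= KDl IH IH'.
elim/tensor_ind: t => [m n|t t' IH IH']; last first.
  by rewrite KDr !linearD /= KDr IH IH'.
rewrite !(KE, tmapE).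
have /= -> := hmod_twist rhoM (x ⊗ₜ m).
by have /= -> := hmod_twist rhoN (y ⊗ₜ n); rewrite !tmapE.
Qed.

Let K_actA p q t :
  K (tmap (hm_twist H) (hm_twist H) p) (K q t)
  = K (tmap (ha_mul H) (ha_mul H) (tmid (p ⊗ₜ q)))
      (tmap (hm_twist M) (hm_twist N) t).
Proof.
elim/tensor_ind: p => [x y|p p' IH IH']; last first.
  by rewrite linearD KDl linearDl !linearD /= KDl IH IH'.
elim/tensor_ind: q => [z w|q q' IH IH']; last first.
  by rewrite KDl KDr linearDr !linearD /= KDl IH IH'.
elim/tensor_ind: t => [m n|t t' IH IH']; last first.
  by rewrite !KDr !linearD /= KDr IH IH'.
rewrite tmidE !tmapE !KE.
have /= := hmod_actA rhoM ((x ⊗ₜ z) ⊗ₜ m); rewrite tassocE !tmapE => <-.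
by have /= := hmod_actA rhoN ((y ⊗ₜ w) ⊗ₜ n); rewrite tassocE !tmapE => <-.
Qed.

Lemma tensor_act_twist :
  hm_twist (tensor_hom_module M N) \o tensor_act
  =1 tensor_act \o tmap (hm_twist H) (hm_twist (tensor_hom_module M N)).
Proof.
move=> /=; elim/tensor_ind => [x t|u u' /= IH IH']; last first.
  by rewrite !linearD /= IH IH'.
rewrite /= tmapE !tensor_actE K_twist.
by have /= -> := (hb_coalgP H).1 x.
Qed.

Lemma tensor_actA :
  tensor_act \o tmap (hm_twist H) tensor_act \o @tassoc _ H H (M ⊗ N)
  =1 tensor_act \o tmap (ha_mul H) (hm_twist (tensor_hom_module M N)).
Proof.
elim/tensor_ind => [p t|u u' /= IH IH']; last first.
  by rewrite !linearD /= IH IH'.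
elim/tensor_ind: p => [x y|p p' /= IH IH']; last first.
  by rewrite linearDl !linearD /= IH IH'.
rewrite /= tassocE !tmapE /= !tensor_actE.
have /= <- := (hb_coalgP H).1 x; rewrite K_actA.
by have /= -> := hb_comulM (x ⊗ₜ y); rewrite tmapE.
Qed.

Definition tensor_hmodule : hmodule H (tensor_hom_module M N) :=
  @HModule H (tensor_hom_module M N) tensor_act tensor_act_twist tensor_actA.

End TensorHModule.

Section TwistedHModule.
Variables (H : hom_alg) (M : hom_module) (rho : hmodule H M).

Definition twisted_act : H ⊗ M -> M :=
  rho \o tmap (hm_twist H \o hm_twist H) idfun.

HB.instance Definition _ := GRing.Linear.on twisted_act.

Lemma twisted_act_twist :
  hm_twist M \o twisted_act =1 twisted_act \o tmap (hm_twist H) (hm_twist M).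
Proof.
elim/tensor_ind => [x m|u u' /= IH IH']; last by rewrite !linearD /= IH IH'.
rewrite /twisted_act /= !tmapE /=.
by have /= -> := hmod_twist rho (hm_twist H (hm_twist H x) ⊗ₜ m); rewrite tmapE.
Qed.

Lemma twisted_actA :
  twisted_act \o tmap (hm_twist H) twisted_act \o @tassoc _ H H M
  =1 twisted_act \o tmap (ha_mul H) (hm_twist M).
Proof.
elim/tensor_ind => [p m|u u' /= IH IH']; last by rewrite !linearD /= IH IH'.
elim/tensor_ind: p => [x y|p p' /= IH IH']; last first.
  by rewrite linearDl !linearD /= IH IH'.
set a := hm_twist H.
rewrite /= tassocE !tmapE /= /twisted_act /= !tmapE /=.
have /= := hmod_actA rho ((a (a x) ⊗ₜ a (a y)) ⊗ₜ m).
rewrite tassocE !tmapE => ->.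
have /= -> := (ha_algP H).1 (x ⊗ₜ y); rewrite tmapE.
by have /= -> := (ha_algP H).1 (a x ⊗ₜ a y); rewrite tmapE.
Qed.

Definition twisted_hmodule : hmodule H M :=
  @HModule H M twisted_act twisted_act_twist twisted_actA.

End TwistedHModule.

(* Sweedler's notation: the sum is over any decomposition of Δ x into pure
   tensors; one exists by [tensor_decomp]. *)
Definition module_hom_algebra_axiom (H : hom_bialg) (A : hom_alg)
    (rho : hmodule H A) : Prop :=
  forall (x : H) (a b : A) (s : seq (H * H)),
    hb_comul H x = \sum_(p <- s) p.1 ⊗ₜ p.2 ->
    rho ((hm_twist H \o hm_twist H) x ⊗ₜ ha_mul A (a ⊗ₜ b))
    = \sum_(p <- s) ha_mul A (rho (p.1 ⊗ₜ a) ⊗ₜ rho (p.2 ⊗ₜ b)).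

End HomStructures.

(* Main.v *)
Require Import Defs.
From mathcomp Require Import all_boot all_order all_algebra.

Import GRing.Theory.
Local Open Scope ring_scope.

(** Both sides of the morphism equation [mu \o rho_AA = rho^{2,0} \o (Id ⊗ mu)]
    are linear in H ⊗ (A ⊗ A), so it suffices to compare them on
    x ⊗ (a ⊗ b).  There the right-hand side is alpha_H^2(x)(ab) and the
    left-hand side, computed from any decomposition of the comultiplication of
    x into pure tensors ([tensor_act_sweedler]), is the sum of the products
    (x_1 a)(x_2 b): on pure tensors the equation is the module Hom-algebra
    axiom.  The remaining requirement on a morphism, compatibility of mu with
    the twisting maps, is the multiplicativity of alpha_A. *)

Lemma tensor_act_sweedler {k : comNzRingType} {H : hom_bialg k}
    {M N : hom_module k} (rhoM : hmodule H M) (rhoN : hmodule H N)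
    {x : H} (m : M) (n : N) {s : seq (H * H)} :
  hb_comul H x = \sum_(p <- s) p.1 ⊗ₜ p.2 ->
  tensor_hmodule rhoM rhoN (x ⊗ₜ (m ⊗ₜ n))
  = \sum_(p <- s) rhoM (p.1 ⊗ₜ m) ⊗ₜ rhoN (p.2 ⊗ₜ n).
Proof.
move=> Dx; rewrite /= /tensor_act /= tmapE Dx linear_sumlz.
(* The linear maps are named because a map out of a tensor product is itself a
   sum over a representative, which unification would otherwise expose. *)
rewrite (linear_sum (@tmid _ H H M N)) (linear_sum (tmap rhoM rhoN)).
by apply: eq_bigr => p _; rewrite /= tmidE tmapE.
Qed.

(** Pure tensors generate a tensor product; this applies once for each tensor
    sign. *)
Lemma tensor3_ext (k : comNzRingType) (U V W X : lmodType k)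
    (f g : {linear U ⊗ (V ⊗ W) -> X}) :
  (forall u v w, f (u ⊗ₜ (v ⊗ₜ w)) = g (u ⊗ₜ (v ⊗ₜ w))) -> f =1 g.
Proof.
move=> fg; apply: tensor_ext => u; elim/tensor_ind => [v w|t t' IH IH'].
  exact: fg.
by rewrite linearDr !linearD /= IH IH'.
Qed.

Theorem theorem5p4 (k : comNzRingType)
    (char0 : forall n : nat, n%:R = 0 :> k -> n = 0%N)
    (H : hom_bialg k) (A : hom_alg k) (rho : hmodule H A) :
  module_hom_algebra_axiom rho <->
  hmodule_morphism (tensor_hmodule rho rho) (twisted_hmodule rho) (ha_mul A).
Proof.
have lhsE x a b s : hb_comul H x = \sum_(p <- s) p.1 ⊗ₜ p.2 ->
    (ha_mul A \o tensor_hmodule rho rho) (x ⊗ₜ (a ⊗ₜ b))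
    = \sum_(p <- s) ha_mul A (rho (p.1 ⊗ₜ a) ⊗ₜ rho (p.2 ⊗ₜ b)).
  move=> Dx; rewrite -(linear_sum (ha_mul A)).
  exact/(congr1 (ha_mul A))/tensor_act_sweedler.
have rhsE x a b :
    (twisted_hmodule rho \o tmap idfun (ha_mul A)) (x ⊗ₜ (a ⊗ₜ b))
    = rho ((hm_twist H \o hm_twist H) x ⊗ₜ ha_mul A (a ⊗ₜ b)).
  by rewrite /= /twisted_act /= !tmapE.
split=> [axiomA | [_ mu_act] x a b s Dx]; last first.
  by rewrite -rhsE -mu_act; exact: lhsE.
split; first exact: (ha_algP A).1.
apply: tensor3_ext => x a b.
have [s Dx] := tensor_decomp (hb_comul H x).
exact: etrans (lhsE _ _ _ _ Dx) (esym (etrans (rhsE _ _ _) (axiomA _ _ _ _ Dx))).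
Qed.
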